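(* For every $t\in\mathbb{N}$ there exists a finite supersoluble group $G$ such that $d(G)=t$ and $G$ can be generated by $t$ elements whose orders are pairwise coprime.
   Context: For a finite group $G$, $d(G)$ denotes the minimal number of generators of $G$. *)

(* Defs.v *)
From mathcomp Require Import all_boot all_fingroup all_solvable.

Set Implicit Arguments.
Unset Strict Implicit.
Unset Printing Implicit Defensive.

Local Open Scope group_scope.

Section Supersoluble.

Variable gT : finGroupType.
Implicit Types G H K : {group gT}.

(* Since both H and K are normal in G, K lies in 'N(H), so K / H is a genuine
   quotient. *)
Definition normal_cyclic_factor G H K :=
  [&& H \subset K, H <| G, K <| G & cyclic (K / H)].

(* There is a finite series 1 = G_0 <= G_1 <= ... <= G_n = G whose terms are
   normal in the whole of G (not merely in the next term, which would only give
   solubility) and whose factors are cyclic. *)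
Definition supersoluble G : Prop :=
  exists s : seq {group gT},
    path (normal_cyclic_factor G) 1%G s /\ last 1%G s = G.

End Supersoluble.

(* Main.v *)
From HB Require Import structures.
Require Import Defs.
From mathcomp Require Import all_boot all_order all_algebra.
From mathcomp Require Import all_fingroup all_solvable all_field.

(* Choose distinct primes q_1, ..., q_t and a prime p = 1 modulo their product,
   so that F_p^* has an element c_i of order q_i.  In the supersoluble group of
   maps w |-> v + c w of F_p^t, let x_i be the homothety of ratio c_i centred at
   the basis vector e_i; it has order q_i and translation part (1 - c_i) e_i.
   The maps with translation part in a fixed subspace form a subgroup, so the
   translation parts of any generators of G = <x_1, ..., x_t> span F_p^t:
   at least t of them are needed. *)

Set Implicit Arguments.
Unset Strict Implicit.
Unset Printing Implicit Defensive.

Import GRing.Theory.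

Local Open Scope group_scope.

(** * Subgroups of supersoluble groups and a cyclicity criterion *)

(** Intersecting the series with [H] works: by the second isomorphism theorem each new factor embeds
    in an old one. *)
Lemma supersolubleS (gT : finGroupType) (G H : {group gT}) :
  H \subset G -> supersoluble G -> supersoluble H.
Proof.
move=> sHG [s [path_s last_s]]; pose f (K : {group gT}) := (K :&: H)%G.
have f1 : f 1%G = 1%G by apply/val_inj/setIidPl; rewrite sub1G.
exists (map f s); split; last first.
  by rewrite -f1 last_map last_s; apply/val_inj/setIidPr.
rewrite -f1 path_map; apply: sub_path path_s => L K /and4P[sLK nLG nKG cycKL].
have nfH (M : {group gT}) : M <| G -> f M <| H.
  by move=> nMG; rewrite /f /= setIC; apply: normalGI nMG.
apply/and4P; split; rewrite ?nfH //; first by rewrite setSI.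
have fL : f L = (L :&: f K)%G.
  by apply/val_inj; rewrite /= setIA (setIidPl sLK).
rewrite fL (isog_cyclic (second_isog _)); last first.
  exact: subset_trans (subset_trans (subsetIr _ _) sHG) (normal_norm nLG).
by apply: cyclicS cycKL; rewrite quotientS ?subsetIl.
Qed.

Lemma cyclic_mul_quotient (gT : finGroupType) (H K : {group gT}) (y : gT) :
  y \in 'N(H) -> K \subset H * <[y]> -> cyclic (K / H).
Proof.
move=> nHy /(quotientS H); rewrite quotientMidl quotient_cycle //.
by move/cyclicS; apply; apply: cycle_cyclic.
Qed.

(** * Cyclotomic polynomials and primes congruent to 1 modulo [n] *)

(** Both binomials are products of ['Phi_d] over divisors, and ['Phi_n] does not occur in X^m - 1;
    [r] collects the remaining factors. *)
Lemma Xn_sub_1_Cyclotomic_factor (n m : nat) :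
    0 < n -> m %| n -> m != n ->
  exists r : {poly int}, ('X^n - 1 = 'Phi_n * ('X^m - 1) * r)%R.
Proof.
move=> n_gt0 m_dv_n m_neq_n.
have m_gt0 : 0 < m by apply: dvdn_gt0 m_dv_n.
rewrite -!prod_Cyclotomic // (big_rem n) -?dvdn_divisors //=.
pose s := [seq d <- rem n (divisors n) | d \notin divisors m].
exists (\prod_(d <- s) 'Phi_d)%R; rewrite -mulrA; congr (_ * _)%R.
rewrite (bigID (mem (divisors m))) /= -[X in (X * _)%R]big_filter.
rewrite -[X in (_ * X)%R]big_filter; congr (_ * _)%R; apply: perm_big.
apply: uniq_perm; rewrite ?filter_uniq ?rem_uniq ?divisors_uniq // => d.
rewrite mem_filter mem_rem_uniq ?divisors_uniq // inE -!dvdn_divisors //.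
have [d_dv_m | //] := boolP (d %| m); rewrite (dvdn_trans d_dv_m) //= andbT.
by apply: contraNneq m_neq_n => dn; rewrite eqn_dvd m_dv_n -dn.
Qed.

(** If the order m of [z] were a proper divisor of [n], then [z] would be a common root of ['Phi_n]
    and X^m - 1, hence a double root of X^n - 1, which is separable. *)
Lemma Cyclotomic_primitive_root (F : fieldType) (n : nat) (z : F) :
    (n%:R != 0 :> F)%R -> root (map_poly intr 'Phi_n) z ->
  n.-primitive_root%R z.
Proof.
move=> nF0 rootz.
have n_gt0 : 0 < n by case: n nF0 {rootz} => //; rewrite eqxx.
have XnE m : map_poly (intr : int -> F) ('X^m - 1)%R = ('X^m - 1)%R.
  by rewrite rmorphB /= map_polyXn rmorph1.
have zn1 : (z ^+ n = 1)%R.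
  have /(congr1 (map_poly (intr : int -> F))) := prod_Cyclotomic n_gt0.
  rewrite XnE (big_rem n) -?dvdn_divisors //= rmorphM => /(congr1 (horner^~ z)).
  rewrite hornerM (rootP rootz) mul0r !hornerE => /esym/eqP.
  by rewrite subr_eq0 => /eqP.
have [m prim_m m_dv_n] := prim_order_exists n_gt0 zn1.
have [<- // | m_neq_n] := eqVneq m n.
have [r /(congr1 (map_poly (intr : int -> F)))] :=
  Xn_sub_1_Cyclotomic_factor n_gt0 m_dv_n m_neq_n.
rewrite !rmorphM /= !XnE => XnEr; have := separable_Xn_sub_1 nF0.
rewrite XnEr !separable_mul => /andP[/and3P[_ _ co] _].
have := coprimep_root co rootz.
by rewrite !hornerE (prim_expr_order prim_m) subrr eqxx.
Qed.

(* Take a prime factor [p] of [Phi_n(a)], for a multiple [a] of [n] that is not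
   a root of [Phi_n ^ 2 - 1]; as [p] divides [a^n - 1], it is coprime to [n]. *)
Lemma exists_prime_1_mod (n : nat) : 0 < n -> exists2 p, prime p & n %| p.-1.
Proof.
move=> n_gt0; pose P := ('Phi_n ^+ 2 - 1)%R : {poly int}.
(* One candidate more than [P] can have roots. The shift [k.+2] ensures a > 1 even for n = 1, so
   that a^n - 1 and its divisor [y] are nonzero. *)
pose rs := [seq (n * k.+2)%:Z%R | k <- iota 0 (size P)].
have P_neq0 : (P != 0)%R.
  rewrite subr_eq0; apply/eqP => /(congr1 (fun q : {poly int} => (size q).-1)).
  rewrite size_exp size_Cyclotomic size_poly1 /= muln2 => /eqP.
  by rewrite double_eq0 -leqn0 leqNgt totient_gt0 n_gt0.
have /allPn[a rs_a Pa] : ~~ all (root P) rs.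
  apply/negP => /(max_poly_roots P_neq0); rewrite size_map size_iota ltnn.
  move=> rs_lt; suff /rs_lt: uniq rs by [].
  rewrite map_inj_uniq ?iota_uniq // => i j [] /eqP.
  by rewrite eqn_pmul2l // => /eqP[].
have{rs_a} [k aE] : exists k, a = (n * k.+2)%:Z%R.
  by have /mapP[k _ ->] := rs_a; exists k.
set y := ('Phi_n).[a]%R in Pa; set p := pdiv `|y|%N.
have [c yc] : exists c, (y * c = a ^+ n - 1)%R.
  exists (\prod_(d <- rem n (divisors n)) 'Phi_d).[a]%R.
  have := congr1 (horner^~ a) (prod_Cyclotomic n_gt0).
  by rewrite (big_rem n) -?dvdn_divisors //= hornerM !hornerE.
have y_neq0 : (y != 0)%R.
  apply/eqP => y0; move: yc; rewrite y0 mul0r => /esym/eqP.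
  rewrite subr_eq0 aE => /eqP/(congr1 absz); rewrite abszX /= => an1.
  have a_gt1 : 1 < n * k.+2 by rewrite -[2]mul1n leq_mul.
  by have := ltn_expl n a_gt1; rewrite an1 ltnS leqNgt n_gt0.
(* If [y] were 1 or -1, then [a] would be a root of [P]. *)
have p_pr : prime p.
  apply: pdiv_prime; rewrite ltn_neqAle absz_gt0 y_neq0 andbT eq_sym.
  apply: contraNneq Pa => y1; rewrite /root /P !hornerE -/y subr_eq0.
  by rewrite [y]intEsign y1 mulr1 -exprM mulnC exprM sqrrN !expr1n.
have y_Fp : (y%:~R = 0 :> 'F_p)%R.
  have /dvdnP[q yE] := pdiv_dvd `|y|%N.
  rewrite [y]intEsign yE PoszM !rmorphM /= -/p -[(p%:Z)%:~R%R]/(p%:R)%R.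
  by rewrite (pcharf0 (pchar_Fp p_pr)) !mulr0.
have zn1 : ((a%:~R : 'F_p) ^+ n = 1)%R.
  apply/eqP; rewrite -subr_eq0 -rmorphXn -[1%R]/(1%:~R)%R -rmorphB -yc.
  by rewrite rmorphM /= y_Fp mul0r.
have n_Fp : (n%:R != 0 :> 'F_p)%R.
  apply: contra_eq_neq zn1 => n0.
  rewrite aE PoszM rmorphM /= -[(n%:Z)%:~R%R]/(n%:R)%R n0 mul0r.
  by rewrite expr0n gtn_eqF.
have prim_z : n.-primitive_root%R (a%:~R : 'F_p)%R.
  by apply: Cyclotomic_primitive_root; rewrite // /root horner_map /= -/y y_Fp.
have z_neq0 : (a%:~R != 0 :> 'F_p)%R.
  by apply: contra_eq_neq zn1 => ->; rewrite expr0n gtn_eqF.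
(* By Fermat, z^(p-1) = 1, so the order [n] of z = a mod p divides p - 1. *)
exists p => //; rewrite (prim_order_dvd prim_z).
apply/eqP/(mulfI z_neq0); rewrite -exprS prednK ?prime_gt0 // mulr1.
by have := expf_card (a%:~R : 'F_p)%R; rewrite card_Fp.
Qed.

(** * The group of maps w |-> v + c w *)

(* [(v, c)] stands for the map [w |-> v + c w]. *)
Definition homothety (F : finFieldType) (n : nat) : Type :=
  ('rV[F]_n * {unit F})%type.

Section Homothety.
Variables (F : finFieldType) (n : nat).
Local Notation hT := (homothety F n).
Implicit Types (u v : 'rV[F]_n) (c : {unit F}) (x y : hT).

HB.instance Definition _ := Finite.on hT.

(** Composition of maps, with [y] applied first. *)
Definition homothety_mul x y : hT :=
  ((x.1 + FinRing.uval x.2 *: y.1)%R, x.2 * y.2).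
Definition homothety_one : hT := (0%R, 1).
Definition homothety_inv x : hT := ((- (FinRing.uval x.2^-1 *: x.1))%R, x.2^-1).

Fact homothety_mulA : associative homothety_mul.
Proof.
move=> x y z; rewrite /homothety_mul /= mulgA; congr (_, _).
by rewrite scalerDr scalerA addrA.
Qed.

Fact homothety_mul1g : left_id homothety_one homothety_mul.
Proof. by case=> v c; rewrite /homothety_mul /= add0r scale1r mul1g. Qed.

Fact homothety_mulVg : left_inverse homothety_one homothety_inv homothety_mul.
Proof. by move=> x; rewrite /homothety_mul /= addNr mulVg. Qed.

HB.instance Definition _ := Finite_isGroup.Build hT
  homothety_mulA homothety_mul1g homothety_mulVg.

Lemma homothetyM x y : x * y = ((x.1 + FinRing.uval x.2 *: y.1)%R, x.2 * y.2).
Proof. by []. Qed.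

Lemma homothetyV x : x^-1 = ((- (FinRing.uval x.2^-1 *: x.1))%R, x.2^-1).
Proof. by []. Qed.

Lemma homothetyX0 c k : ((0%R, c) : hT) ^+ k = (0%R, c ^+ k).
Proof.
by elim: k => // k IHk; rewrite !expgS IHk homothetyM /= scaler0 addr0.
Qed.

Lemma translationX v k : ((v, 1) : hT) ^+ k = ((v *+ k)%R, 1).
Proof.
elim: k => // k IHk; rewrite !expgS IHk homothetyM /= mulg1.
by rewrite scale1r mulrS.
Qed.

(** The subspace is the row space of [A]; the ratio is unrestricted. *)
Definition translation_in m (A : 'M[F]_(m, n)) : {set hT} :=
  [set x | (x.1 <= A)%MS].

Fact group_set_translation_in m (A : 'M_(m, n)) : group_set (translation_in A).
Proof.
apply/group_setP; split=> [|x y]; rewrite !inE ?sub0mx //= => xA yA.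
by rewrite addmx_sub ?scalemx_sub.
Qed.
Canonical translation_in_group m (A : 'M_(m, n)) :=
  Group (group_set_translation_in A).

(* Translations by vectors whose coordinates of index [>= i] vanish. *)
Definition flag (i : nat) : {set hT} :=
  [set x : hT | (x.2 == 1) &&
    [forall j : 'I_n, (i <= j) ==> (x.1 0%R j == 0%R)]].

Lemma flagP i x :
  reflect (x.2 = 1 /\ forall j : 'I_n, i <= j -> x.1 0%R j = 0%R)
          (x \in flag i).
Proof.
rewrite inE; apply: (iffP andP) => -[/eqP-> x0]; split=> //.
  by move=> j le_ij; apply/eqP/(implyP (forallP x0 j)).
by apply/forallP=> j; apply/implyP=> /x0->.
Qed.

Fact group_set_flag i : group_set (flag i).
Proof.
apply/group_setP; split=> [|x y /flagP[x2 x1] /flagP[y2 y1]]; apply/flagP.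
  by split=> // j _; rewrite mxE.
rewrite homothetyM /= x2 y2 mulg1 scale1r; split=> // j le_ij.
by rewrite mxE x1 ?y1 ?addr0.
Qed.
Canonical flag_group i := Group (group_set_flag i).

Lemma flag0 : flag 0 = 1.
Proof.
apply/setP=> x; rewrite in_set1; apply/flagP/eqP=> [[x2 x1]|->].
  rewrite [x]surjective_pairing x2; congr (_, _).
  by apply/rowP=> j; rewrite x1 ?mxE.
by split=> // j _; rewrite mxE.
Qed.

(** Conjugation turns the translation by v into the translation by a scalar multiple of v, so
    vanishing coordinates still vanish. *)
Lemma flag_normal i : flag i <| [set: hT].
Proof.
apply/andP; split; rewrite ?subsetT //; apply/subsetP=> y _.
rewrite inE; apply/subsetP => _ /imsetP[x /flagP[x2 x1] ->].
apply/flagP; rewrite conjgE !homothetyM homothetyV /= x2 mul1g mulVg.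
split=> // j le_ij.
by rewrite scale1r scalerDr !mxE x1 // mulr0 add0r addNr.
Qed.

(* [w |-> c (w - u) + u] *)
Definition homothety_at (u : 'rV[F]_n) (c : {unit F}) : hT :=
  ((u - FinRing.uval c *: u)%R, c).

(** A translation conjugates this map to the homothety of the same ratio centred at 0. *)
Lemma order_homothety_at u c : #[homothety_at u c] %| #[c].
Proof.
pose y : hT := (u, 1); pose z : hT := (0%R, c).
have -> : homothety_at u c = z ^ y^-1.
  rewrite conjgE invgK !homothetyM homothetyV /= invg1 mulg1 mul1g invr1.
  by rewrite !scale1r add0r scalerN.
by rewrite orderJ order_dvdn homothetyX0 expg_order.
Qed.

Lemma grank_homothety_basis (c : 'I_n -> {unit F}) :
  (forall i, c i != 1) ->
  'm(<<[set homothety_at (delta_mx 0%R i) (c i) | i : 'I_n]>>) = n.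
Proof.
set X := [set _ | i : _] => c_neq1.
apply/eqP; rewrite eqn_leq; apply/andP; split.
  apply: leq_trans (grank_min X) _.
  by apply: leq_trans (leq_imset_card _ _) _; rewrite card_ord.
have [B defB <-] := grank_witness <<X>>.
(* The rows are the translation parts of a smallest generating set [B]; rank [n] for [A] forces at
   least [n] rows. *)
pose A := (\matrix_(i < #|B|) (enum_val i).1)%R.
apply: leq_trans (rank_leq_row A); rewrite -{1}(mxrank1 F n); apply: mxrankS.
have sXA : X \subset translation_in_group A.
  rewrite -gen_subG -defB gen_subG; apply/subsetP=> x Bx; rewrite inE.
  apply: submx_trans (row_sub (enum_rank_in Bx x) A).
  by rewrite rowK enum_rankK_in.
apply/row_subP=> i; rewrite row1.
have : homothety_at (delta_mx 0%R i) (c i) \in X by apply: imset_f.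
(* The translation part is (1 - c_i) e_i with 1 - c_i nonzero, so e_i itself lies in the row
   space. *)
move/(subsetP sXA); rewrite inE /= -{1}[delta_mx _ _]scale1r -scalerBl.
rewrite eqmx_scale // subr_eq0 eq_sym.
by apply: contra (c_neq1 i) => /eqP c1; apply/eqP/val_inj.
Qed.

End Homothety.

(** * Supersolubility over a prime field *)

Section HomothetyFp.

Variables (p n : nat).
Local Notation hT := (homothety 'F_p n).

Lemma cyclic_flagS i : cyclic (flag 'F_p n i.+1 / flag _ n i).
Proof.
(* From index [n] on, the flag is constant: it consists of all translations. *)
have [le_ni | lt_in] := leqP n i.
  rewrite (_ : flag _ _ i.+1 = flag 'F_p n i) ?trivg_quotient ?cyclic1 //.
  apply/setP=> x; apply/flagP/flagP=> -[-> _]; split=> // j.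
    by rewrite leqNgt (leq_trans (ltn_ord j)).
  by rewrite ltnNge (leq_trans (ltnW (ltn_ord j))).
pose k := Ordinal lt_in; pose y : hT := (delta_mx 0%R k, 1).
apply: (@cyclic_mul_quotient _ _ _ y).
  by apply: (subsetP (normal_norm (flag_normal _ _ _))); rewrite inE.
(* Over a prime field the coordinate is a natural multiple of 1, so a power of [y] cancels it. *)
apply/subsetP=> x /flagP[x2 x1]; pose m : nat := x.1 0%R k.
rewrite -(mulgKV (y ^+ m) x) mem_mulg ?mem_cycle //; apply/flagP.
rewrite translationX homothetyM homothetyV /= x2 mul1g invg1.
split=> // j le_ij.
rewrite /= invr1 !scale1r !mxE -scaler_nat !mxE eqxx /= /m.
have [->|neq_jk] := eqVneq j k; first by rewrite mulr1 natr_Zp subrr.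
rewrite mulr0 subr0 x1 // ltn_neqAle le_ij andbT.
apply: contra neq_jk => /eqP ij.
by apply/eqP/val_inj.
Qed.

(** Modulo translations only the ratio remains, and the unit group of a finite field is cyclic. *)
Lemma cyclic_homothety_quotient : cyclic ([set: hT] / flag _ n n).
Proof.
have /cyclicP[c defU] := field_unit_group_cyclic [set: {unit 'F_p}].
pose y : hT := (0%R, c).
apply: (@cyclic_mul_quotient _ _ [set: hT]%G y).
  by apply: (subsetP (normal_norm (flag_normal _ _ _))); rewrite inE.
apply/subsetP=> x _; have /cycleP[k xk] : x.2 \in <[c]> by rewrite -defU inE.
rewrite -(mulgKV (y ^+ k) x) mem_mulg ?mem_cycle //; apply/flagP.
rewrite homothetyX0 homothetyM homothetyV /= xk mulgV; split=> // j.
by rewrite leqNgt ltn_ord.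
Qed.

Lemma supersoluble_homothety : supersoluble [set: hT].
Proof.
(* The series is flag 0 = 1, flag 1, ..., flag n, whole group; [H] starts at flag 1 because [path]
   supplies the trivial term. *)
pose H i := if i < n then flag_group 'F_p n i.+1 else [set: hT]%G.
pose s := mkseq H n.+1.
exists s; split; last by rewrite -nth_last nth_mkseq size_mkseq // /H ltnn.
apply/(pathP 1%G) => i; rewrite size_mkseq => lt_in.
have -> : nth 1%G (1%G :: s) i = flag_group 'F_p n i.
  case: i lt_in => [_|i lt_in] /=; first by apply/val_inj; rewrite /= flag0.
  by rewrite nth_mkseq ?(ltnW lt_in) // /H -ltnS lt_in.
rewrite nth_mkseq // /H; apply/and4P; split; rewrite ?flag_normal //.
- case: ifP => _; rewrite ?subsetT //; apply/subsetP=> x /flagP[x2 x1].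
  by apply/flagP; split=> // j /ltnW/x1.
- by case: ifP => _; rewrite ?flag_normal.
case: ltnP => [_|le_ni]; first exact: cyclic_flagS.
have -> : i = n by apply/eqP; rewrite eqn_leq le_ni -ltnS lt_in.
exact: cyclic_homothety_quotient.
Qed.

End HomothetyFp.

(** * Choice of the primes and of the ratios *)

Theorem proposition3p2 (t : nat) :
  exists (gT : finGroupType) (G : {group gT}),
    supersoluble G /\ 'm(G) = t /\
    exists x : 'I_t -> gT,
      <<[set x i | i : 'I_t]>> = G /\
      (forall i j : 'I_t, i != j -> coprime #[x i] #[x j]).
Proof.
(* Iterating at least once from 0 makes every [q i] prime, and the sequence is strictly
   increasing. *)
pose next m := s2val (prime_above m); pose q i := iter i.+1 next 0.
have q_pr i : prime (q i) by apply: (s2valP' (prime_above _)).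
have q_inj : injective q.
  apply/incn_inj/leq_mono; apply: homo_ltn => [|i]; first exact: ltn_trans.
  exact: (s2valP (prime_above (q i))).
have q_gt0 : 0 < \prod_(i < t) q i by apply: prodn_gt0 => i; apply: prime_gt0.
have [p p_pr q_dv_p1] := exists_prime_1_mod q_gt0.
have c_ex (i : 'I_t) : {c : {unit 'F_p} | #[c] = q i}.
  have q_dv : q i %| #|[set: {unit 'F_p}]|.
    rewrite card_finField_unit card_Fp // (dvdn_trans _ q_dv_p1) //.
    by rewrite (bigD1 i) ?dvdn_mulr.
  by have [c _ <-] := Cauchy (q_pr i) q_dv; exists c.
pose c i := sval (c_ex i).
have order_c i : #[c i] = q i by rewrite /c; case: (c_ex i).
pose x i := homothety_at (delta_mx 0%R i) (c i).
pose gT : finGroupType := homothety 'F_p t.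
exists gT, <<[set x i | i : 'I_t]>>%G; split; last split.
- exact: supersolubleS (subsetT _) (supersoluble_homothety p t).
- apply: grank_homothety_basis => i.
  by rewrite -order_gt1 order_c prime_gt1.
exists x; split=> // i j neq_ij.
(* The orders divide the distinct primes [q i] and [q j], which suffices. *)
apply: coprime_dvdl (order_homothety_at _ _) _.
apply: coprime_dvdr (order_homothety_at _ _) _; rewrite !order_c.
rewrite prime_coprime // dvdn_prime2 //.
by apply: contra neq_ij => /eqP/q_inj/val_inj->.
Qed.
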